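(* Let $p$ be an odd prime and let $R_p$ be the dihedral quandle on $\mathbb{Z}_p$. Then the third rack homology group satisfies $H_3^R(R_p)\cong \mathbb{Z}\oplus\mathbb{Z}_p$.
   Context: $\mathbb{Z}_k=\mathbb{Z}/k\mathbb{Z}$. The dihedral quandle $R_k$ is the set $\mathbb{Z}_k$ with the operation $a*b=2b-a$. For a rack $X$ (a set with a binary operation $*$ such that for every $b$ the map $a\mapsto a*b$ is a bijection and $(a*b)*c=(a*c)*(b*c)$ for all $a,b,c$), the rack chain complex is defined as follows. For $n\ge 1$, $C_n^R(X)$ is the free abelian group generated by $n$-tuples $(x_1,\dots,x_n)$ of elements of $X$, with boundary homomorphism $\partial: C^R_n(X)\to C^R_{n-1}(X)$, $$\partial(x_1,\ldots,x_n)=\sum_{i=2}^n(-1)^i\big((x_1,\ldots,x_{i-1},x_{i+1},\ldots,x_n)-(x_1*x_i,\ldots,x_{i-1}*x_i,x_{i+1},\ldots,x_n)\big)$$ (so $\partial=0$ on $C_1^R(X)$). Rack homology $H_n^R(X)$ is the homology of $(C_*^R(X),\partial)$. *)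

(* Defs.v *)
From HB Require Import structures.
From mathcomp Require Import all_boot all_order all_algebra.
From mathcomp Require Import ring_quotient boolp freeg ring.

Set Implicit Arguments.
Unset Strict Implicit.
Unset Printing Implicit Defensive.

Import GRing.Theory.
Local Open Scope ring_scope.

HB.mixin Record isRack (X : Type) := {
  rack_op : X -> X -> X;
  rack_op_bij : forall b : X, bijective (rack_op ^~ b);
  rack_opDl : left_distributive rack_op rack_op
}.

#[short(type="rackType")]
HB.structure Definition Rack := {X of isRack X & Choice X}.

(* 'Z_k is the ring of integers mod k only for k > 1. *)
Definition dihedral (k : nat) : Type := 'Z_k.

Section Dihedral.
Variable k : nat.

HB.instance Definition _ := Finite.on (dihedral k).

Definition dihedral_op (a b : dihedral k) : dihedral k :=
  (2%:R * (b : 'Z_k) - (a : 'Z_k) : 'Z_k).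

Lemma dihedral_op_bij (b : dihedral k) : bijective (dihedral_op ^~ b).
Proof. by exists (dihedral_op ^~ b) => a; rewrite /dihedral_op subKr. Qed.

Lemma dihedral_opDl : left_distributive dihedral_op dihedral_op.
Proof.
by move=> a b c; rewrite /dihedral_op; ring.
Qed.

HB.instance Definition _ :=
  isRack.Build (dihedral k) dihedral_op_bij dihedral_opDl.

End Dihedral.

Section RackHomology.
Variable X : rackType.

Definition rack_chain (n : nat) : zmodType := {freeg (n.-tuple X) / int}.

(* fintype.lift i enumerates the positions other than i in increasing order. *)
Definition face0 (n : nat) (x : n.-tuple X) (i : 'I_n) : n.-1.-tuple X :=
  [tuple tnth x (fintype.lift i j) | j < n.-1].

Definition face1 (n : nat) (x : n.-tuple X) (i : 'I_n) : n.-1.-tuple X :=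
  [tuple let k := fintype.lift i j in
         if (k < i)%N then rack_op (tnth x k) (tnth x i) else tnth x k
   | j < n.-1].

(* Positions are numbered from 0, so the sum over i = 2, ..., n with sign
   (-1)^i becomes a sum over 0 < i < n with sign (-1)^(i+1). *)
Definition rack_boundary_gen (n : nat) (x : n.-tuple X) :
    {freeg (n.-1.-tuple X) / int} :=
  \sum_(i < n | (0 < i)%N)
     ((-1) ^+ i.+1 : int) *: (<< face0 x i >> - << face1 x i >>).

Definition rack_boundary (n : nat) (c : rack_chain n) : rack_chain n.-1 :=
  fglift (@rack_boundary_gen n) c.

Lemma rack_boundary_is_zmod_morphism n : zmod_morphism (@rack_boundary n).
Proof. exact: lift_is_additive. Qed.

HB.instance Definition _ n :=
  GRing.isZmodMorphism.Build (rack_chain n) (rack_chain n.-1) (@rack_boundary n)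
    (@rack_boundary_is_zmod_morphism n).

Definition is_cycle (n : nat) : {pred rack_chain n} :=
  fun c => rack_boundary c == 0.

Lemma is_cycle_zmod_closed n : zmod_closed (@is_cycle n).
Proof.
split=> [|x y]; rewrite !unfold_in; first by rewrite raddf0.
by move=> /eqP x0 /eqP y0; rewrite raddfB /= x0 y0 subrr.
Qed.

HB.instance Definition _ n :=
  GRing.isZmodClosed.Build (rack_chain n) (@is_cycle n)
    (@is_cycle_zmod_closed n).

Record rack_cycle (n : nat) :=
  RackCycle { cycle_val : rack_chain n; _ : cycle_val \in @is_cycle n }.

HB.instance Definition _ n := [isSub for @cycle_val n].
HB.instance Definition _ n := [Choice of rack_cycle n by <:].
HB.instance Definition _ n := [SubChoice_isSubZmodule of rack_cycle n by <:].

(* Since the boundary squares to zero, this is the whole image of the boundary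
   map out of degree n+1, seen as a subgroup of the cycles. *)
Definition is_boundary (n : nat) : {pred rack_cycle n} :=
  fun z => `[< exists c : rack_chain n.+1, rack_boundary c = val z >].

Lemma is_boundary_zmod_closed n : zmod_closed (@is_boundary n).
Proof.
split=> [|x y]; first by apply/asboolP; exists 0; rewrite !raddf0.
move=> /asboolP[c cx] /asboolP[d dy]; apply/asboolP.
by exists (c - d); rewrite !raddfB /= cx dy.
Qed.

HB.instance Definition _ n :=
  GRing.isZmodClosed.Build (rack_cycle n) (@is_boundary n)
    (@is_boundary_zmod_closed n).

(* Only n >= 1 is meaningful: the complex starts in degree 1. *)
Definition rack_homology (n : nat) : zmodType :=
  Quotient.quot (@is_boundary n).

End RackHomology.

Definition isomorphic (A B : zmodType) : Prop :=
  exists f : {additive A -> B}, bijective f.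

(* Main.v *)
Require Import Defs.
From mathcomp Require Import all_boot all_order all_algebra.
From HB Require Import structures.
From mathcomp Require Import generic_quotient ring_quotient boolp freeg ring.
(* A triple (a, b, c) is written in the coordinates z = c, k = b - c, u = a - b.

   Upper bound on homology.  Let X be a 3-cocycle with values in a group killed
   by p, normalized by X 0 0 0 = 0.  The part of X even in u is a family of
   2-cocycles, and every 2-cocycle is a constant plus a coboundary, so it can be
   removed.  The part odd in k then does not depend on z and has the form
   f (k + u) - f (k - u), so it can be removed as well.  For what remains,
   sigma z = sum_k X z k 1 is an affine function of z.  Subtracting a multiple
   of the cocycle u * carry z k makes sigma constant, and a cocycle with
   constant sigma is a coboundary: solving F z (k + 1) - F z (k - 1) = X z k 1
   (up to a correction) is possible because the right-hand side sums to zero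
   over k, and the cocycle relation propagates the vanishing from u = 1 to all
   u.  Applied to the tautological cocycle with values in C_3 / (B_3 + p C_3),
   this shows that a 3-cycle of degree 0 on which the carry cocycle vanishes is
   a boundary modulo p.

   Averaging over the first coordinates shows that p kills the classes of
   degree 0, which removes "modulo p".  Finally degree and carry cocycle take
   all values on the cycles (0, 0, 0) and
   sum_k (k + 2, k + 1, 1) - sum_k (k + 1, k, 0). *)

Set Implicit Arguments.
Unset Strict Implicit.
Unset Printing Implicit Defensive.
Import GRing.Theory.
Local Open Scope ring_scope.
Local Open Scope quotient_scope.

(** * Linear identities in abelian groups *)

(* [ring] does not apply to a bare zmodType: [zmod] proves identities there by
   comparing integer coefficients, [zlin H] proves e when H and e have the same
   difference of sides, and [zcongr f] identifies occurrences of f whose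
   arguments are equal up to [zmod]. *)

Inductive zexpr :=
  | ZVar of nat | ZZero | ZAdd of zexpr & zexpr | ZOpp of zexpr
  | ZMuln of zexpr & nat.

Fixpoint zeval (V : zmodType) (env : seq V) e : V :=
  match e with
  | ZVar i => env`_i
  | ZZero => 0
  | ZAdd e1 e2 => zeval env e1 + zeval env e2
  | ZOpp e1 => - zeval env e1
  | ZMuln e1 n => zeval env e1 *+ n
  end.

Fixpoint zcoef e i : int :=
  match e with
  | ZVar j => ((i == j) : nat)%:Z
  | ZZero => 0
  | ZAdd e1 e2 => zcoef e1 i + zcoef e2 i
  | ZOpp e1 => - zcoef e1 i
  | ZMuln e1 n => zcoef e1 i *+ n
  end.

Lemma zevalE (V : zmodType) (env : seq V) e :
  zeval env e = \sum_(i < size env) env`_i *~ zcoef e i.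
Proof.
elim: e => [j||e1 IH1 e2 IH2|e1 IH1|e1 IH1 n] /=.
- have [lt_j|le_j] := ltnP j (size env).
    rewrite (bigD1 (Ordinal lt_j)) //= eqxx mulr1z big1 ?addr0 // => i.
    by rewrite -val_eqE /= => /negPf ->.
  rewrite nth_default // big1 // => i _.
  by rewrite ltn_eqF ?mulr0z // (leq_trans (ltn_ord i)).
- by rewrite big1 // => i _; rewrite mulr0z.
- by rewrite IH1 IH2 -big_split; apply: eq_bigr => i _; rewrite mulrzDr.
- by rewrite IH1 -sumrN; apply: eq_bigr => i _; rewrite mulrNz.
- rewrite IH1 -sumrMnl; apply: eq_bigr => i _.
  by rewrite [LHS]pmulrn -mulrzA -[n%:Z]intz -pmulrn mulr_natr.
Qed.

Definition zcheck n e1 e2 :=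
  all (fun i => zcoef e1 i == zcoef e2 i) (iota 0 n).

Lemma zeval_eq (V : zmodType) (env : seq V) e1 e2 :
  zcheck (size env) e1 e2 = true -> zeval env e1 = zeval env e2.
Proof.
move=> /allP eq12; rewrite !zevalE; apply: eq_bigr => i _.
by rewrite (eqP (eq12 i _)) // mem_iota /=.
Qed.

Lemma zmod_lin (V : zmodType) (a b l r : V) : l = r -> a + r = b + l -> a = b.
Proof. by move=> -> /addIr. Qed.

Lemma eqD (V : zmodType) (a b c d : V) : a = b -> c = d -> a + c = b + d.
Proof. by move=> -> ->. Qed.

Lemma eqN (V : zmodType) (a b : V) : a = b -> - a = - b.
Proof. by move=> ->. Qed.

Ltac zindex x env :=
  lazymatch env with
  | nil => constr:(O)
  | x :: _ => constr:(O)
  | _ :: ?env' => let i := zindex x env' in constr:(S i)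
  end.

Ltac zmem x env :=
  lazymatch env with
  | nil => constr:(false)
  | x :: _ => constr:(true)
  | _ :: ?env' => zmem x env'
  end.

Ltac znum n :=
  lazymatch n with
  | O => idtac
  | S ?m => znum m
  end.

(** The backtracking [match] matters: when a multiplier is not a numeral, [znum] fails and the whole
    multiple becomes an atom. *)
Ltac zatoms e env :=
  match e with
  | GRing.zero => env
  | @GRing.add _ ?a ?b => let env1 := zatoms a env in zatoms b env1
  | @GRing.opp _ ?a => zatoms a env
  | @GRing.natmul _ ?a ?n =>
      let _ := match goal with _ => znum n end in
      zatoms a env
  | _ => let b := zmem e env in
         lazymatch b with true => env | false => constr:(e :: env) end
  end.

Ltac zreify e env :=
  match e with
  | GRing.zero => constr:(ZZero)
  | @GRing.add _ ?a ?b =>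
      let a1 := zreify a env in let b1 := zreify b env in constr:(ZAdd a1 b1)
  | @GRing.opp _ ?a => let a1 := zreify a env in constr:(ZOpp a1)
  | @GRing.natmul _ ?a ?n =>
      let _ := match goal with _ => znum n end in
      let a1 := zreify a env in constr:(ZMuln a1 n)
  | _ => let i := zindex e env in constr:(ZVar i)
  end.

Ltac zsize env :=
  lazymatch env with
  | nil => constr:(O)
  | _ :: ?env' => let n := zsize env' in constr:(S n)
  end.

Ltac zproof a b :=
  let V := type of a in
  let env1 := zatoms a (@nil V) in
  let env := zatoms b env1 in
  let ea := zreify a env in
  let eb := zreify b env in
  let n := zsize env in
  let chk := constr:(@erefl bool true <: zcheck n ea eb = true) in
  constr:(@zeval_eq _ env ea eb chk : a = b).

Ltac zmod :=
  lazymatch goal with |- ?a = ?b => let e := zproof a b in exact e end.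

Ltac zlin H := apply: (zmod_lin H); zmod.

Ltac zcongr X :=
  repeat match goal with
  | |- context [X ?a ?b ?c] =>
    match goal with
    | |- context [X ?a' ?b' ?c'] =>
      tryif constr_eq (X a b c) (X a' b' c') then fail else
      (let ea := zproof a a' in let eb := zproof b b' in
       let ec := zproof c c' in
       rewrite (_ : X a b c = X a' b' c');
       [|exact (f_equal3 X ea eb ec)])
    end
  end.

Ltac zcongr1 X :=
  repeat match goal with
  | |- context [X ?a] =>
    match goal with
    | |- context [X ?a'] =>
      tryif constr_eq (X a) (X a') then fail else
      (let ea := zproof a a' in
       rewrite (_ : X a = X a'); [|exact (f_equal X ea)])
    end
  end.

Ltac zcongr2 X :=
  repeat match goal with
  | |- context [X ?a ?b] =>
    match goal with
    | |- context [X ?a' ?b'] =>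
      tryif constr_eq (X a b) (X a' b') then fail else
      (let ea := zproof a a' in let eb := zproof b b' in
       rewrite (_ : X a b = X a' b'); [|exact (f_equal2 X ea eb)])
    end
  end.

(** * Two- and three-cocycles *)

Section Cochains.
Variable p : nat.
Variable V : zmodType.

(* A function of (a, b) is written F z u with z = b, u = a - b.  In d3 the
   arguments stand for the 4-tuple (z + k + v + u, z + k + v, z + k, z). *)
Definition d2 (F : 'Z_p -> 'Z_p -> V) (z k u : 'Z_p) : V :=
  F z (k + u) - F z (k - u) - F (z + k) u + F (z - k) (- u).

Definition d3 (X : 'Z_p -> 'Z_p -> 'Z_p -> V) (z k v u : 'Z_p) : V :=
  X z k (v + u) - X z k (v - u) - X z (k + v) u + X z (k - v) (- u)
  + X (z + k) v u - X (z - k) (- v) (- u).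

Lemma d3_d2 F z k v u : d3 (d2 F) z k v u = 0.
Proof. by rewrite /d3 /d2; zcongr2 F; zmod. Qed.

Lemma d3_sub_cst X (e : V) z k v u :
  d3 (fun z k u => X z k u - e) z k v u = d3 X z k v u.
Proof. by rewrite /d3; zmod. Qed.

End Cochains.

(** * Halving modulo an odd prime, and triviality of 2-cocycles *)

Section OddPrime.
Variable p : nat.
Hypotheses (p_prime : prime p) (p_odd : odd p).

(** [p.+1./2] inverts 2 modulo [p]; written as a natural multiple, the same halving works in any
    group killed by [p] (see [vhalf]). *)
Definition zhalf (x : 'Z_p) : 'Z_p := x *+ p.+1./2.

Lemma natr_p : p%:R = 0 :> 'Z_p.
Proof. by rewrite -Zp_nat_mod ?prime_gt1 // modnn. Qed.

Lemma doublehalfp : (p.+1./2 * 2 = p.+1)%N.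
Proof. by rewrite muln2 -[RHS](odd_double_half p.+1) /= p_odd. Qed.

Lemma half_mul2 x : zhalf x *+ 2 = x.
Proof. by rewrite -mulrnA doublehalfp mulrS -mulr_natr natr_p mulr0 addr0. Qed.

Lemma mul2_half x : zhalf (x *+ 2) = x.
Proof. by rewrite -[RHS]half_mul2 /zhalf -!mulrnA mulnC. Qed.

Lemma double_inj (x y : 'Z_p) : x *+ 2 = y *+ 2 -> x = y.
Proof. by move=> e; rewrite -[x]mul2_half e mul2_half. Qed.

Lemma halfN x : zhalf (- x) = - zhalf x.
Proof. by rewrite /zhalf mulNrn. Qed.

Lemma Zp_ind (P : 'Z_p -> Prop) :
  P 0 -> (forall x, P x -> P (x + 1)) -> forall x, P x.
Proof.
move=> P0 PS x; rewrite -[x]natr_Zp; elim: (x : nat) => [//|n IHn].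
by rewrite -addn1 natrD; apply: PS.
Qed.

Section TwoCocycles.
Variable V : zmodType.
Variable B : 'Z_p -> 'Z_p -> V.
Hypothesis d2B : forall z k u, d2 B z k u = 0.

(* The pair (z + u, z) moves z + u to z - u; t r x is the weight of the move
   from x to x + 2r. *)
Let t (r x : 'Z_p) := B (x + r) (- r) - B 0 0.

(** The cocycle relation as path independence: both sides weigh a two-move path from [x] to
    [x + 2s - 2r]. *)
Let tE (s r x : 'Z_p) :
  t s x + t (- r) (x + s *+ 2) = t r x + t (s - r *+ 2) (x + r *+ 2).
Proof.
have := d2B (x + s) (r - s) (- r).
rewrite /d2 /t; zcongr2 B => H; zlin H.
Qed.

Let t0 (x : 'Z_p) : t 0 x = 0.
Proof.
have := tE (zhalf x) 0 0; rewrite mul0rn oppr0 half_mul2 !addr0 add0r.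
by rewrite addrC => /addIr ->; rewrite /t oppr0 addr0 subrr.
Qed.

Let tN (r x : 'Z_p) : t (- r) (x + r *+ 2) = - t r x.
Proof.
(* With [r] doubled, two instances of [tE] differ from the goal only by moves of length 0. *)
rewrite -[r]half_mul2; move: (zhalf r) => {}r.
have H1 := tE (r *+ 2) r x; have H2 := tE (- (r *+ 2)) (- r) (x + r *+ 4).
move: H1 H2 (t0 (x + r *+ 2)); zcongr2 t => H1 H2 H0.
zlin (eqD (eqD H1 H2) (eqD H0 H0)).
Qed.

Let t_step (s e z : 'Z_p) :
  t (s + e *+ 2) z = t e z + t s (z + e *+ 2) + t e (z + s *+ 2 + e *+ 2).
Proof.
have := tE (s + e *+ 2) e z; have := tN e (z + s *+ 2 + e *+ 2).
by zcongr2 t => H2 H1; zlin (eqD H1 (eqN H2)).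
Qed.

Let t_add1 (y x : 'Z_p) : t (y + 1) x = t y x + t 1 (x + y *+ 2).
Proof.
move: 1 (@Zp_ind) => e ind.
(* Splitting [e] off at the end and at the start are proved together: [t_step] removes [e] at both
   ends, so each splitting follows from the other one for [y]. *)
have [] : (forall z, t (y + e) z = t y z + t e (z + y *+ 2))
       /\ (forall z, t (y + e) z = t e z + t y (z + e *+ 2)).
  elim/ind: y => [|y [IHr IHl]].
    by split=> z; rewrite !t0 ?add0r ?mul0rn ?addr0.
  have y2 : y + e + e = y + e *+ 2 by zmod.
  split=> z; rewrite y2 t_step.
    by have := IHl z; zcongr2 t => H; zlin (eqN H).
  by have := IHr (z + e *+ 2); zcongr2 t => H; zlin (eqN H).
by [].
Qed.

(** Additivity of [t] along paths makes it the difference of the potential [t m 0] at [2m]; the pair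
    [(z + u, z)] is the move by [-2u] from [z + u]. *)
Lemma two_cocycle_coboundary z u :
  B z u = B 0 0 + B (zhalf (z - u)) (- zhalf (z - u))
               - B (zhalf (z + u)) (- zhalf (z + u)).
Proof.
have tD n m : t n (m *+ 2) = t (m + n) 0 - t m 0.
  elim/Zp_ind: n => [|n IHn]; first by rewrite t0 addr0 subrr.
  have := t_add1 (m + n) 0; have := t_add1 n (m *+ 2); move: IHn.
  by zcongr2 t => H1 H2 H3; zlin (eqD (eqD H1 H2) (eqN H3)).
have := tD (- u) (zhalf (z + u)); rewrite half_mul2.
have -> : zhalf (z + u) - u = zhalf (z - u).
  by apply: double_inj; rewrite half_mul2 mulrnDl half_mul2; zmod.
by rewrite /t !add0r addrK opprK => H; zlin H.
Qed.

End TwoCocycles.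
End OddPrime.

Section Sums.
Variable p : nat.
Hypotheses (p_prime : prime p) (p_odd : odd p).
Variable V : zmodType.
Implicit Type f : 'Z_p -> V.

Lemma sum_shift f (c : 'Z_p) : \sum_v f (c + v) = \sum_v f v.
Proof. by rewrite [RHS](reindex_inj (addrI c)). Qed.

Lemma sum_opp f : \sum_v f (- v) = \sum_v f v.
Proof. by rewrite [RHS](reindex_inj oppr_inj). Qed.

Lemma sum_double f : \sum_v f (v *+ 2) = \sum_v f v.
Proof. by rewrite [RHS](reindex_inj (@double_inj p p_prime p_odd)). Qed.

Lemma sum_cst (x : V) : \sum_(v : 'Z_p) x = x *+ p.
Proof. by rewrite sumr_const card_ord Zp_cast // prime_gt1. Qed.

End Sums.

(** * Multiples and parity of 3-cocycles *)

Section ThreeCocycles.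
Variable p : nat.
Hypotheses (p_prime : prime p) (p_odd : odd p).
Variable V : zmodType.
Implicit Types (X Y : 'Z_p -> 'Z_p -> 'Z_p -> V) (F : 'Z_p -> 'Z_p -> V).

Definition cocycle X := forall z k v u, d3 X z k v u = 0.

Definition cohomologous X Y :=
  exists F, forall z k u, X z k u = Y z k u + d2 F z k u.

Lemma cohomologous_trans X Y Z :
  cohomologous X Y -> cohomologous Y Z -> cohomologous X Z.
Proof.
move=> [F XY] [G YZ]; exists (fun z u => F z u + G z u) => z k u.
by rewrite XY YZ /d2; zmod.
Qed.

(* Summing the cocycle relation over its second entry turns p X into a function
   B of the last two entries, up to a coboundary; B is a 2-cocycle. *)
Lemma cocycle_mulp X : cocycle X ->
  cohomologous (fun z k u => X z k u *+ p) (fun _ _ _ => X 0 0 0 *+ p).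
Proof.
move=> cX.
pose B z k := \sum_u X z k u; pose F z (u : 'Z_p) := \sum_k X z k (u - k).
have XE z k w : X z k w *+ p = B z k + d2 F z k w.
  (* The choice [u = w - v] keeps [v + u = w] fixed, so the first term of [d3] contributes [p]
     copies of [X z k w]. *)
  have /eqP : \sum_v d3 X z k v (w - v) = 0.
    by rewrite big1 // => v _; apply: cX.
  rewrite /d3 !(big_split, sumrN) /=.
  have -> : \sum_v X z k (v + (w - v)) = X z k w *+ p.
    by rewrite -sum_cst //; apply: eq_bigr => v _; congr X; zmod.
  have -> : \sum_v X z k (v - (w - v)) = B z k.
    (* The last entry is [2v - w], which runs through all residues because [p] is odd. *)
    rewrite /B -[RHS](sum_shift _ (- w)) -[RHS](sum_double p_prime p_odd).
    by apply: eq_bigr => v _; congr X; zmod.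
  have -> : \sum_v X z (k + v) (w - v) = F z (k + w).
    rewrite /F -[RHS](sum_shift _ k).
    by apply: eq_bigr => v _; congr X; zmod.
  have -> : \sum_v X z (k - v) (- (w - v)) = F z (k - w).
    rewrite /F -[RHS](sum_shift _ k) -[RHS]sum_opp.
    by apply: eq_bigr => v _; congr X; zmod.
  have -> : \sum_v X (z + k) v (w - v) = F (z + k) w by [].
  have -> : \sum_v X (z - k) (- v) (- (w - v)) = F (z - k) (- w).
    by rewrite /F -[RHS]sum_opp; apply: eq_bigr => v _; congr X; zmod.
  by rewrite /d2 => /eqP H; zlin H.
have d2B z k v : d2 B z k v = 0.
  (* Now the sum is over the last entry, so the terms with [v + u] and [v - u] both give [B z k] and
     cancel. *)
  have : \sum_u d3 X z k v u = 0 by rewrite big1 // => u _; apply: cX.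
  rewrite /d3 !(big_split, sumrN) /=.
  have -> : \sum_u X z k (v + u) = B z k by rewrite sum_shift.
  have -> : \sum_u X z k (v - u) = B z k.
    by rewrite (sum_opp (fun u => X z k (v + u))) sum_shift.
  rewrite (sum_opp (X z (k - v))) (sum_opp (X (z - k) (- v))).
  rewrite -[_ = 0]/(B z k - B z k - B z (k + v) + B z (k - v) + B (z + k) v
                    - B (z - k) (- v) = 0) => H.
  by rewrite /d2; zlin (eqN H).
have BE := two_cocycle_coboundary p_prime p_odd d2B.
have X0 : X 0 0 0 *+ p = B 0 0.
  by rewrite XE /d2; zcongr2 F; zmod.
(* On a cochain [G z] independent of [u], [d2] is [G (z - k) - G (z + k)], the shape that
   [two_cocycle_coboundary] gives to [B]. *)
exists (fun z u => F z u + B (zhalf z) (- zhalf z)) => z k u.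
by rewrite X0 XE BE /d2; zmod.
Qed.

(** The relation at [k = 0], [v = u] removes the dependence on [u]; at [k = z], [v = u = 0] it
    compares the base points [2z] and 0. Normalizing one value thus kills the whole slice
    [k = 0]. *)
Lemma cocycle_eq0 X z u : cocycle X -> X z 0 u = X 0 0 0.
Proof.
move=> cX.
have H1 (y w : 'Z_p) : X y 0 w = X y 0 0.
  have := cX y 0 (zhalf w) (zhalf w).
  by rewrite /d3 -mulr2n half_mul2 //; zcongr X => H; zlin H.
rewrite H1 -[z](half_mul2 p_prime p_odd); have := cX (zhalf z) (zhalf z) 0 0.
by rewrite /d3 -mulr2n; zcongr X => H; zlin H.
Qed.

Hypothesis mulp : forall m : V, m *+ p = 0.

Definition vhalf (m : V) : V := m *+ p.+1./2.

Lemma vhalf2 m : vhalf m + vhalf m = m.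
Proof. by rewrite -mulr2n -mulrnA doublehalfp // mulrS mulp addr0. Qed.

Lemma vdouble_inj (x y : V) : x + x = y + y -> x = y.
Proof.
move=> e; rewrite -[x]vhalf2 -[y]vhalf2 /vhalf -!mulrnDl.
by rewrite e.
Qed.

Definition odd_last X := forall z k u, X z k (- u) = - X z k u.
Definition even_mid X := forall z k u, X z (- k) u = X z k u.
Definition vanishing_mid X := forall z u, X z 0 u = 0.

(** Adding the relations for [u] and [-u] cancels the terms with [v + u] and [v - u], so twice the
    even part is a 2-cocycle in [(z, k)], the coboundary of some [G u]. Half of [G], read as a
    2-cochain even in [u], removes it: the terms of [d2] at [k + u] and [k - u] form an odd function
    of [u]. *)
Lemma cocycle_odd_last X : cocycle X -> vanishing_mid X ->
  exists Y, [/\ cohomologous X Y, cocycle Y, vanishing_mid Y & odd_last Y].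
Proof.
move=> cX X0.
pose B u z k := X z k u + X z k (- u).
have BN u z k : B (- u) z k = B u z k by rewrite /B opprK addrC.
have d2B u z k v : d2 (B u) z k v = 0.
  have := cX z k v (- u); have := cX z k v u.
  by rewrite /d3 /d2 /B; zcongr X => H1 H2; zlin (eqN (eqD H1 H2)).
have BE u := two_cocycle_coboundary p_prime p_odd (d2B u).
pose G u z := B u (zhalf z) (- zhalf z).
pose F z u := vhalf (G u z).
have FN z u : F z (- u) = F z u by rewrite /F /G BN.
have F2 z u : F z u + F z u = G u z by apply: vhalf2.
pose Y z k u := X z k u - d2 F z k u.
exists Y; split.
- by exists F => z k u; rewrite subrK.
- move=> z k v u; have := cX z k v u; have := d3_d2 F z k v u.
  by rewrite /Y /d3 => H1 H2; zlin (eqD H2 (eqN H1)).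
- by move=> z u; rewrite /Y X0 /d2 !add0r !addr0 !subr0; zmod.
- move=> z k u; have := BE u z k.
  have -> : B u 0 0 = 0 by rewrite /B !X0 addr0.
  rewrite -/(G u (z - k)) -/(G u (z + k)) -!F2 {1}/B => H.
  rewrite /Y /d2 opprK !FN.
  by zlin H.
Qed.

End ThreeCocycles.

Section Multiples.
Variable p : nat.
Hypotheses (p_prime : prime p) (p_odd : odd p).

Lemma Zp_multiple (a d : 'Z_p) : d != 0 -> exists n, a = d *+ n.
Proof.
move=> d0; have p1 := prime_gt1 p_prime.
have ud : d \is a GRing.unit.
  rewrite -[d]natr_Zp unitZpE // prime_coprime // gtnNdvd ?lt0n //.
  by rewrite -[X in (_ < X)%N](Zp_cast p1).
exists (d^-1 * a : 'Z_p); rewrite -mulr_natr natr_Zp mulVKr //.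
Qed.

Variable V : zmodType.
Implicit Types (X Y : 'Z_p -> 'Z_p -> 'Z_p -> V) (F : 'Z_p -> 'Z_p -> V).
Hypothesis mulp : forall m : V, m *+ p = 0.
Let vhalf2 := vhalf2 p_odd mulp.

Lemma cocycle_sub_coboundary X F : cocycle X ->
  cocycle (fun z k u => X z k u - d2 F z k u).
Proof.
move=> cX z k v u; have := cX z k v u; have := d3_d2 F z k v u.
by rewrite /d3 => H1 H2; zlin (eqD H2 (eqN H1)).
Qed.

Lemma cocycle_odd_lastE X z k v u : cocycle X -> odd_last X ->
  X z k (v + u) - X z k (v - u)
  = X z (k + v) u + X z (k - v) u - X (z + k) v u - X (z - k) (- v) u.
Proof. by move=> cX oX; have := cX z k v u; rewrite /d3 !oX => H; zlin H. Qed.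

(** * The part odd in the middle coordinate *)

Section OddMid.
Variable X : 'Z_p -> 'Z_p -> 'Z_p -> V.
Hypotheses (cX : cocycle X) (oX : odd_last X) (X0 : vanishing_mid X).

Let D z v u := X z v u - X z (- v) u.

(** The relations at [v] and [-v] have the same left-hand side because [X] is odd in its last
    entry. *)
Let D_shift z k v u : D (z + k) v u = D (z - k) v u.
Proof.
have := cocycle_odd_lastE z k v u cX oX.
have := cocycle_odd_lastE z k (- v) u cX oX.
have := oX z k (v + u); have := oX z k (v - u).
rewrite /D; zcongr X => O2 O1 H2 H1.
zlin (eqD (eqD H1 (eqN H2)) (eqD (eqN O1) O2)).
Qed.

Let O k u := D 0 k u.

Let DO z v u : D z v u = O v u.
Proof.
have := D_shift (zhalf z) (zhalf z) v u.
by rewrite subrr -mulr2n half_mul2.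
Qed.

Let O_add K v u : O K (v + u) - O K (v - u) = O (K + v) u + O (K - v) u.
Proof.
have := cocycle_odd_lastE 0 K v u cX oX.
have := cocycle_odd_lastE 0 (- K) v u cX oX.
have := D_shift 0 K v u.
by rewrite /O /D; zcongr X => H0 H1 H2; zlin (eqD (eqD H2 (eqN H1)) (eqN H0)).
Qed.

Let ONr k u : O k (- u) = - O k u.
Proof. by rewrite /O /D !oX; zmod. Qed.

Let ONl k u : O (- k) u = - O k u.
Proof. by rewrite /O /D opprK; zmod. Qed.

Let O0 u : O 0 u = 0.
Proof. by rewrite /O /D oppr0 subrr. Qed.

Let f a := O (zhalf a) (zhalf a).

Let fN a : f (- a) = f a.
Proof. by rewrite /f halfN ONr ONl opprK. Qed.

(** [O] behaves like the product [k * u], and this is the analogue of [(a + d) (a - d) = a^2 - d^2].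
    For [d != 0] every [a] is a multiple of [d], which allows induction along multiples of [d], with
    [O_add] as the step. *)
Let OE k u : O k u = f (k + u) - f (k - u).
Proof.
have step (a d : 'Z_p) : O (a + d) (a - d) = O a a - O d d ->
    O (a + d + d) (a + d - d) = O (a + d) (a + d) - O d d.
  have := O_add (a + d) (- d) a; have := ONr (a + d) (a + d).
  by zcongr2 O => H2 H3 H1; zlin (eqD (eqD H1 (eqN H3)) (eqN H2)).
have W (a d : 'Z_p) : O (a + d) (a - d) = O a a - O d d.
  have [->|/(Zp_multiple a) [n ->]] := eqVneq d 0.
    by rewrite addr0 subr0 O0 subr0.
  elim: n => [|n IHn]; first by rewrite mulr0n !add0r O0 ONr sub0r.
  by rewrite mulrSr; apply: step.
by rewrite -W; congr O; apply: double_inj => //;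
  rewrite !(mulrnDl, mulNrn, half_mul2) //; zmod.
Qed.

(** Since [f] is even, [d2] of half of [f] is half of [f (k + u) - f (k - u)], hence half of [D]:
    exactly the part of [X] odd in [k]. *)
Lemma cocycle_even_mid :
  exists Y, [/\ cohomologous X Y, cocycle Y, vanishing_mid Y, odd_last Y
              & even_mid Y].
Proof.
pose F (z u : 'Z_p) := vhalf p (f u).
have FN z u : F z (- u) = F z u by rewrite /F fN.
have F2 z u : F z u + F z u = f u by apply: vhalf2.
have Fz z u : F z u = F 0 u by [].
exists (fun z k u => X z k u - d2 F z k u); split.
- by exists F => z k u; rewrite subrK.
- exact: cocycle_sub_coboundary.
- move=> z u; have := FN 0 u.
  by rewrite X0 /d2 !(Fz (_ + _)) !(Fz z); zcongr2 F => ->; zmod.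
- move=> z k u; have := FN 0 u.
  by rewrite oX /d2 !(Fz (_ + _)) !(Fz z); zcongr2 F => ->; zmod.
- move=> z k u; have := OE k u; rewrite -!(F2 0) -(DO z) /D.
  have := FN 0 (k + u); have := FN 0 (k - u).
  rewrite /d2 !(Fz (_ + _)) !(Fz z); zcongr2 F => H1 H2 H.
  zlin (eqD (eqN H) (eqD (eqN H1) H2)).
Qed.

End OddMid.

End Multiples.

(** * The carry cocycle and the classification *)

Section Carry.
Variable p : nat.
Hypotheses (p_prime : prime p) (p_odd : odd p).

Definition zrepr (x : 'Z_p) : int := (x : nat)%:Z.

(* Mochizuki's cocycle is (a - b) ((2c - b)^p + b^p - 2c^p) / p.  The p-th
   powers only serve as integer lifts of residues, and any other lift does. *)
Definition carry (z k : 'Z_p) : int :=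
  ((zrepr (z + k) + zrepr (z - k) - zrepr z *+ 2) %/ p%:Z)%Z.

Definition carry_cocycle (z k u : 'Z_p) : 'Z_p := u * (carry z k)%:~R.

Lemma Zp_intr_eq0 (n : int) : n%:~R = 0 :> 'Z_p -> (p %| n)%Z.
Proof.
have natP m : m%:R = 0 :> 'Z_p -> (p %| m)%N.
  by move=> /(congr1 val); rewrite /= val_Zp_nat ?prime_gt1 // => /eqP.
rewrite dvdzE; case: n => m; first by apply: natP.
by rewrite NegzE abszN mulrNz => /eqP; rewrite oppr_eq0 => /eqP/natP.
Qed.

Lemma carryE z k :
  carry z k * p%:Z = zrepr (z + k) + zrepr (z - k) - zrepr z *+ 2.
Proof.
apply: divzK; apply: Zp_intr_eq0.
by rewrite mulr2n mulrzBr !mulrzDr -!pmulrn !natr_Zp; zmod.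
Qed.

Lemma carryC z k : carry z (- k) = carry z k.
Proof. by rewrite /carry opprK [X in X - _]addrC. Qed.

Lemma carry0 z : carry z 0 = 0.
Proof. by rewrite /carry addr0 subr0 -mulr2n subrr div0z. Qed.

Lemma p_neq0 : p%:Z != 0.
Proof. by rewrite eqz_nat -lt0n prime_gt0. Qed.

(** The factor [u] comes out of the relation and leaves an integer identity between carries;
    multiplied by [p], it is formal in second differences of [zrepr]. *)
Lemma carry_cocycleP : cocycle carry_cocycle.
Proof.
move=> z k v u; rewrite /d3 /carry_cocycle.
have : carry z k *+ 2 - carry z (k + v) - carry z (k - v)
        + carry (z + k) v + carry (z - k) (- v) = 0.
  apply: (mulIf p_neq0).
  rewrite mul0r !(mulrDl, mulNr, mulrnAl) !carryE //.
  by zcongr1 zrepr; zmod.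
move/(congr1 (fun n => n%:~R : 'Z_p)).
rewrite mulr2n !(mulrzDr, mulrzBr) mulr0z => H.
by rewrite -[RHS](mulr0 u) -H; ring.
Qed.

(** Sums of residues over a translated or reflected full period do not depend on [z]. The slope -2
    is invertible modulo [p], which lets the carry cocycle adjust any affine [sigma] and take all
    values on cycles. *)
Lemma sum_carry (z : 'Z_p) :
  \sum_k carry z k = \sum_k carry (0 : 'Z_p) k - zrepr z *+ 2.
Proof.
apply: (mulIf p_neq0); rewrite mulrBl !mulr_suml.
have S (y : 'Z_p) : \sum_k carry y k * p%:Z
    = \sum_(k : 'Z_p) zrepr k *+ 2 - zrepr y *+ 2 * p%:Z.
  under eq_bigr => k _ do rewrite carryE.
  rewrite !(big_split, sumrN) /= sum_cst // (sum_shift zrepr).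
  rewrite (sum_opp (fun k => zrepr (y + k))) (sum_shift zrepr).
  by congr (_ - _); rewrite -[p%:Z]natz mulr_natr mulr2n mulrnDl.
by rewrite !S /zrepr /= mul0rn mul0r subr0.
Qed.

End Carry.

(** * Difference equations on the cycle of residues *)

Section Telescoping.
Variable p : nat.
Hypotheses (p_prime : prime p) (p_odd : odd p).
Variable V : zmodType.
Hypothesis mulp : forall m : V, m *+ p = 0.

(** Partial sums solve the equation, and the vanishing total lets them close up when [j + 1] wraps
    to 0. *)
Lemma telescope_Zp (e : 'Z_p -> V) : \sum_j e j = 0 ->
  exists G : 'Z_p -> V, forall j, G (j + 1) = G j + e j.
Proof.
move=> e0; pose G n := \sum_(0 <= i < n) e i%:R.
have Gp : G p = 0.
  rewrite /G -[X in \sum_(_ <= _ < X) _](Zp_cast (prime_gt1 p_prime)) big_mkord.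
  by rewrite -[RHS]e0; apply: eq_bigr => i _; rewrite natr_Zp.
exists (fun j => G (j : nat)) => j.
have -> : j + 1 = (j.+1)%:R :> 'Z_p by rewrite -natr1 natr_Zp.
have GS : G j.+1 = G j + e j by rewrite /G big_nat_recr //= natr_Zp.
rewrite val_Zp_nat ?prime_gt1 // -GS.
have : (j < p)%N by rewrite -[X in (_ < X)%N](Zp_cast (prime_gt1 p_prime)).
rewrite leq_eqVlt => /orP[/eqP->|lt_jp]; first by rewrite modnn Gp /G big_nil.
by rewrite modn_small.
Qed.

Lemma telescope_odd (E : 'Z_p -> V) :
    \sum_k E k = 0 -> (forall k, E (- k) = E k) ->
  exists F : 'Z_p -> V, [/\ forall k, F (k + 1) - F (k - 1) = E k,
    forall k, F (- k) = - F k & F 1 + F 1 = E 0].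
Proof.
move=> E0 EN.
have [|G GE] := @telescope_Zp (fun j => E (j *+ 2 + 1)).
  rewrite -[RHS]E0 -[RHS](sum_shift _ 1) -[RHS](sum_double p_prime p_odd).
  by apply: eq_bigr => j _; rewrite addrC.
have {}GE k : G (zhalf (k + 1)) - G (zhalf (k - 1)) = E k.
  have -> : zhalf (k + 1) = zhalf (k - 1) + 1.
    apply: double_inj => //; rewrite mulrnDl !half_mul2 //.
    by move: 1 => e; zmod.
  rewrite GE [G _ + _]addrC addrK half_mul2 //.
  by move: 1 => e; rewrite subrK.
(* The free constant of the solution is fixed so that [F 1] is half of [E 0], which forces
   [F (- 1) = - F 1]. *)
pose F t := G (zhalf t) - (G (zhalf 1) - vhalf p (E 0)).
have FE k : F (k + 1) - F (k - 1) = E k by rewrite -GE /F; zmod.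
have F1 : F 1 + F 1 = E 0 by rewrite -(vhalf2 p_odd mulp (E 0)) /F; zmod.
exists F; split=> // t; apply/eqP; rewrite -addr_eq0 addrC.
pose D t := F t + F (- t); rewrite -/(D t).
have D1 : D 1 = 0.
  by have := FE 0; rewrite -F1 /D; move: 1 => e; zcongr1 F => H; zlin (eqN H).
have DS k : D (k + 1) = D (k - 1).
  have := FE (- k); rewrite EN -(FE k) /D; move: 1 => e.
  by zcongr1 F => H; zlin (eqN H).
(* [D] vanishes at 1 and has period 2, and the residues [1 + 2j] exhaust ['Z_p]. *)
have -> : t = 1 + zhalf (t - 1) *+ 2.
  by rewrite half_mul2 // addrC subrK.
move: (zhalf _) => j; elim/(@Zp_ind p): j => [|j IHj].
  by rewrite mul0rn addr0 D1.
have := DS (j *+ 2 + 1 *+ 2); move: IHj => /eqP <-; move: 1 => e.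
by zcongr1 D => ->.
Qed.

End Telescoping.

(** * Classification of 3-cocycles with values killed by [p] *)

Section Classification.
Variable p : nat.
Hypotheses (p_prime : prime p) (p_odd : odd p).
Variable V : zmodType.
Implicit Types (X Y : 'Z_p -> 'Z_p -> 'Z_p -> V).
Hypothesis mulp : forall m : V, m *+ p = 0.

Definition sigma X (z : 'Z_p) := \sum_k X z k 1.

(** In the relation at [u = 1], summed over [v], the left-hand side cancels. The resulting vanishing
    second difference makes [sigma] affine. *)
Lemma sigma_affine X z r : cocycle X -> odd_last X ->
  sigma X (z + r) + sigma X (z - r) = sigma X z + sigma X z.
Proof.
move=> cX oX.
have : \sum_v (X z r (v + 1) - X z r (v - 1)) = \sum_v
    (X z (r + v) 1 + X z (r - v) 1 - X (z + r) v 1 - X (z - r) (- v) 1).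
  by apply: eq_bigr => v _; apply: cocycle_odd_lastE.
rewrite !(big_split, sumrN) /=.
have shiftr f (c : 'Z_p) : \sum_v f (v + c) = \sum_v f v :> V.
  by rewrite [RHS](reindex_inj (addIr c)).
rewrite !(shiftr (X z r)) subrr (sum_shift (fun v => X z v 1)).
rewrite (sum_opp (fun v => X z (r + v) 1)) (sum_shift (fun v => X z v 1)).
rewrite (sum_opp (fun v => X (z - r) v 1)) -!/(sigma _ _) => H.
by zlin H.
Qed.

Lemma cocycle_sigma_cst X : cocycle X -> odd_last X -> even_mid X ->
    vanishing_mid X -> (forall z, sigma X z = sigma X 0) ->
  cohomologous X (fun _ _ _ => 0).
Proof.
move=> cX oX eX X0 sX.
(* [h] prescribes [F z 1]; only its total matters, which must cancel [sigma]. A constant [h] would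
   have total 0, as [p] kills [V], so the mass sits at one point. *)
pose h (y : 'Z_p) := if y == 0 then - vhalf p (sigma X 0) else 0.
have sum_h : \sum_y h y = - vhalf p (sigma X 0).
  by rewrite (bigD1 0) //= big1 ?addr0 /h ?eqxx // => y /negPf->.
pose E z k := X z k 1 + h (z + k) + h (z - k).
have E0 z : \sum_k E z k = 0.
  rewrite !big_split /= (sum_shift h) (sum_opp (fun k => h (z + k))).
  rewrite (sum_shift h) sum_h -/(sigma X z) sX.
  by rewrite -[X in X - _ - _](vhalf2 p_odd mulp); zmod.
have EN z k : E z (- k) = E z k by rewrite /E eX opprK; zmod.
have [F FP] := choice (fun z => telescope_odd p_prime p_odd mulp (E0 z) (EN z)).
have F1 z : F z 1 = h z.
  apply: (vdouble_inj p_odd mulp); have [_ _ ->] := FP z.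
  by rewrite /E X0 add0r addr0 subr0.
have FN z u : F z (- u) = - F z u by have [_ ->] := FP z.
have FE z k : F z (k + 1) - F z (k - 1) = E z k by have [->] := FP z.
pose Y z k u := X z k u - d2 F z k u.
have cY : cocycle Y by apply: cocycle_sub_coboundary.
have oY : odd_last Y.
  by move=> z k u; rewrite /Y /d2 oX !FN; zcongr2 F; zmod.
have Y1 z k : Y z k 1 = 0 by rewrite /Y /d2 FE !FN !F1 /E; zmod.
have YN1 z k : Y z k (- 1) = 0 by rewrite oY Y1 oppr0.
(* Once [Y] vanishes at [u = 1], the relation there says that [Y] has period 2 in its last entry. *)
have Yper z k v : Y z k (v + 1 *+ 2) = Y z k v.
  have := cocycle_odd_lastE z k (v + 1) 1 cY oY; rewrite !Y1.
  by move: 1 => e; zcongr Y => H; zlin H.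
have Y0 z k : Y z k 0 = 0.
  apply: (vdouble_inj p_odd mulp); have := oY z k 0; rewrite oppr0 => {2}->.
  by rewrite subrr addr0.
exists F => z k u; rewrite add0r; apply/eqP; rewrite -subr_eq0 -/(Y z k u).
rewrite -[u](half_mul2 p_prime p_odd); move: (zhalf u) => {}u.
elim/(@Zp_ind p): u => [|u /eqP IHu]; first by rewrite mul0rn Y0.
by rewrite mulrnDl Yper IHu.
Qed.

Definition zpact (w : V) (r : 'Z_p) : V := w *+ (r : nat).

Lemma zpact_nat w n : zpact w n%:R = w *+ n.
Proof.
rewrite /zpact val_Zp_nat ?prime_gt1 // [in RHS](divn_eq n p).
by rewrite mulrnDr mulnC mulrnA mulp mul0rn add0r.
Qed.

Lemma zpactD w r s : zpact w (r + s) = zpact w r + zpact w s.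
Proof.
by rewrite -[r in LHS]natr_Zp -[s in LHS]natr_Zp -natrD zpact_nat mulrnDr.
Qed.

Lemma zpact0 w : zpact w 0 = 0.
Proof. by []. Qed.

Lemma zpactN w r : zpact w (- r) = - zpact w r.
Proof. by apply/eqP; rewrite -addr_eq0 -zpactD addNr. Qed.

Lemma zpact_sum w (I : finType) (f : I -> 'Z_p) :
  zpact w (\sum_i f i) = \sum_i zpact w (f i).
Proof. exact: (big_morph _ (zpactD w)). Qed.

Lemma zpact1 w : zpact w 1 = w.
Proof. exact: (zpact_nat w 1). Qed.

Theorem cocycle_classification X : cocycle X -> X 0 0 0 = 0 ->
  exists w, cohomologous X (fun z k u => zpact w (carry_cocycle z k u)).
Proof.
move=> cX X0; have vX z u : X z 0 u = 0 by rewrite (cocycle_eq0 p_prime p_odd).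
have [Y1 [XY1 cY1 vY1 oY1]] := cocycle_odd_last p_prime p_odd mulp cX vX.
have [Y [Y1Y cY vY oY eY]] := cocycle_even_mid p_prime p_odd mulp cY1 oY1 vY1.
(* [sigma] of the carry cocycle has slope -2, so the coefficient [w] must satisfy [-2w = t]. *)
pose t := sigma Y 1 - sigma Y 0; pose w := - vhalf p t.
have sY z : sigma Y z = sigma Y 0 + zpact t z.
  have sS y : sigma Y (y + 1) = sigma Y y + t.
    elim/(@Zp_ind p): y => [|y IHy]; first by rewrite add0r /t addrC subrK.
    have := sigma_affine (y + 1) 1 cY oY; rewrite addrK IHy => H.
    by apply: (addIr (sigma Y y)); rewrite H; zmod.
  elim/(@Zp_ind p): z => [|z IHz]; first by rewrite zpact0 addr0.
  by rewrite sS IHz zpactD zpact1 -addrA.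
pose C z k u := zpact w (@carry_cocycle p z k u).
have sC z : sigma C z = sigma C 0 + zpact t z.
  have CE y : sigma C y = zpact w ((\sum_k carry y k)%:~R).
    rewrite -[_%:~R]/(_ *~ _) mulrz_sumr zpact_sum.
    by apply: eq_bigr => k _; rewrite /C /carry_cocycle mul1r.
  have w2 : w + w = - t by rewrite /w -opprD (vhalf2 p_odd mulp).
  rewrite !CE sum_carry // mulrzBr zpactD zpactN mulr2n mulrzDr -pmulrn natr_Zp.
  by rewrite zpactD -mulrnDl w2 mulNrn opprK.
have vC : vanishing_mid C.
  by move=> z u; rewrite /C /carry_cocycle carry0 mulr0z mulr0.
have oC : odd_last C.
  by move=> z k u; rewrite /C /carry_cocycle mulNr zpactN.
have eC : even_mid C by move=> z k u; rewrite /C /carry_cocycle carryC.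
have cC : cocycle C.
  move=> z k v u; have := congr1 (zpact w) (carry_cocycleP p_prime z k v u).
  by rewrite /d3 !(zpactD, zpactN).
exists w; rewrite -/C; apply: cohomologous_trans XY1 _.
apply: cohomologous_trans Y1Y _.
have [||||z|F FE] := @cocycle_sigma_cst (fun z k u => Y z k u - C z k u).
- move=> z k v u; have := cC z k v u; have := cY z k v u.
  by rewrite /d3 => H1 H2; zlin (eqD H1 (eqN H2)).
- by move=> z k u; rewrite oY oC; zmod.
- by move=> z k u; rewrite eY eC.
- by move=> z u; rewrite vY vC subrr.
- by rewrite /sigma !(big_split, sumrN) /= -!/(sigma _ _) sY sC; zmod.
by exists F => z k u; have := FE z k u; rewrite add0r => H; zlin H.
Qed.

End Classification.

(** * Chains *)

Section LinearExtension.
Variables (K : choiceType) (V : zmodType).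

Lemma freeg_morphism_eq0 (f : {freeg K / int} -> V) :
  zmod_morphism f -> (forall x, f << x >> = 0) -> forall D, f D = 0.
Proof.
move=> fB f0 D; pose fA := GRing.isZmodMorphism.Build _ _ f fB.
pose g : {additive {freeg K / int} -> V} := HB.pack_for {additive _ -> _} f fA.
rewrite -[f]/(g : _ -> _) -[D]freeg_sumE raddf_sum big1 // => x _.
by rewrite -[coeff x D]intz -freegU_mulz raddfMz /= f0 mul0rz.
Qed.

Lemma freeg_mulrn_eq0 (D : {freeg K / int}) n :
  (0 < n)%N -> D *+ n = 0 -> D = 0.
Proof.
move=> n0 Dn; apply/eqP/freeg_eqP => x; rewrite coeff0; apply/eqP.
have := congr1 (coeff x) Dn; rewrite coeffMn coeff0 => /eqP.
by rewrite Num.Theory.mulrn_eq0 eqn0Ngt n0.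
Qed.

(** [fglift] needs a module as target; [zmodule V] is [V] with its integer scalar action. *)
Definition freeg_ext (f : K -> V) (D : {freeg K / int}) : V :=
  fglift (f : K -> zmodule V) D.

Lemma freeg_extU f x : freeg_ext f << x >> = f x.
Proof. by rewrite /freeg_ext liftU scale1r. Qed.

Lemma freeg_ext_is_zmod_morphism f : zmod_morphism (freeg_ext f).
Proof. exact: (@lift_is_additive _ _ (zmodule V)). Qed.

HB.instance Definition _ f :=
  GRing.isZmodMorphism.Build {freeg K / int} V (freeg_ext f)
    (freeg_ext_is_zmod_morphism f).

End LinearExtension.

Section Boundary.
Variable X : rackType.
Implicit Types a b c d : X.

Lemma rack_boundaryU n (x : n.-tuple X) :
  rack_boundary (<< x >> : rack_chain X n) = rack_boundary_gen x.
Proof. by rewrite /rack_boundary liftU scale1r. Qed.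

Ltac solve_face a :=
  congr (<< _ >>); apply: eq_from_tnth; case=> [[|[|[|//]]] lt_j];
  rewrite tnth_mktuple !(tnth_nth a) //=.

Lemma rack_boundary3 a b c :
  rack_boundary (<< [tuple a; b; c] >> : rack_chain X 3)
  = << [tuple a; c] >> - << [tuple rack_op a b; c] >>
    - << [tuple a; b] >> + << [tuple rack_op a c; rack_op b c] >>.
Proof.
rewrite rack_boundaryU /rack_boundary_gen big_mkcond !big_ord_recl big_ord0 /=.
rewrite add0r addr0 /bump /= !exprS expr0 !(mulN1r, opprK, scale1r, scaleN1r).
rewrite opprD opprK addrA; congr (_ - _ - _ + _); solve_face a.
Qed.

Lemma rack_boundary4 a b c d :
  rack_boundary (<< [tuple a; b; c; d] >> : rack_chain X 4)
  = << [tuple a; c; d] >> - << [tuple rack_op a b; c; d] >>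
    - << [tuple a; b; d] >> + << [tuple rack_op a c; rack_op b c; d] >>
    + << [tuple a; b; c] >>
    - << [tuple rack_op a d; rack_op b d; rack_op c d] >>.
Proof.
rewrite rack_boundaryU /rack_boundary_gen big_mkcond !big_ord_recl big_ord0 /=.
rewrite add0r addr0 /bump /= !exprS expr0 !(mulN1r, opprK, scale1r, scaleN1r).
rewrite opprD opprK !addrA; congr (_ - _ - _ + _ + _ - _); solve_face a.
Qed.

End Boundary.

Section ZmodQuotient.
Variables (R : zmodType) (I : zmodClosed R).

Definition zquot_pi (x : R) : Quotient.quot I := \pi_(Quotient.quot I) x.

Lemma zquot_pi_is_zmod_morphism : zmod_morphism zquot_pi.
Proof. by move=> x y; rewrite /zquot_pi raddfB. Qed.

HB.instance Definition _ :=
  GRing.isZmodMorphism.Build R (Quotient.quot I) zquot_pi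
    zquot_pi_is_zmod_morphism.

Lemma zquot_pi_eq0 x : (zquot_pi x == 0) = (x \in I).
Proof. by rewrite -(raddf0 zquot_pi) -[in RHS](subr0 x) Quotient.idealrBE. Qed.

Lemma zquot_reprK (q : Quotient.quot I) : zquot_pi (repr q) = q.
Proof. exact: reprK. Qed.

(** First isomorphism theorem; the induced map is evaluated on representatives. *)
Lemma zquot_isomorphic (W : zmodType) (f : {additive R -> W}) :
  (forall x, (f x == 0) = (x \in I)) -> (forall y, exists x, f x = y) ->
  isomorphic (Quotient.quot I) W.
Proof.
move=> kerf surjf; pose g (q : Quotient.quot I) := f (repr q).
have gK x : g (zquot_pi x) = f x.
  apply/eqP; rewrite -subr_eq0 -raddfB kerf -zquot_pi_eq0 raddfB /=.
  by rewrite subr_eq0 /zquot_pi reprK.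
have gB : zmod_morphism g.
  by move=> x y; rewrite -[x]zquot_reprK -[y]zquot_reprK -raddfB !gK raddfB.
pose gA := GRing.isZmodMorphism.Build _ _ g gB.
exists (HB.pack_for {additive Quotient.quot I -> W} g gA).
have [h hK] := choice surjf; exists (fun y => zquot_pi (h y)) => [q|y] /=.
  apply/eqP; rewrite -subr_eq0 -[q in _ - q]zquot_reprK -raddfB.
  rewrite zquot_pi_eq0 -kerf raddfB.
  by rewrite hK subrr.
by rewrite gK hK.
Qed.

End ZmodQuotient.

Section BoundaryMod.
Variables (X : rackType) (n N : nat).

(** The subgroup [B_n + N C_n]. The projection to its quotient is the tautological cocycle with
    values killed by [N]; [N = 0] gives [C_n / B_n]. *)
Definition boundary_mod : {pred rack_chain X n} :=
  fun c => `[< exists (b : rack_chain X n.+1) (d : rack_chain X n),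
                 c = rack_boundary b + d *+ N >].

Lemma boundary_mod_zmod_closed : zmod_closed boundary_mod.
Proof.
split=> [|x y].
  by apply/asboolP; exists 0, 0; rewrite raddf0 mul0rn addr0.
move=> /asboolP[b [d ->]] /asboolP[b' [d' ->]]; apply/asboolP.
by exists (b - b'), (d - d'); rewrite raddfB mulrnBl /=; zmod.
Qed.

HB.instance Definition _ :=
  GRing.isZmodClosed.Build (rack_chain X n) boundary_mod
    boundary_mod_zmod_closed.

Lemma boundary_modP (c : rack_chain X n) :
  zquot_pi boundary_mod c = 0 ->
  exists (b : rack_chain X n.+1) (d : rack_chain X n),
    c = rack_boundary b + d *+ N.
Proof. by move=> /eqP; rewrite zquot_pi_eq0 => /asboolP. Qed.

Lemma boundary_mod_boundary (b : rack_chain X n.+1) :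
  zquot_pi boundary_mod (rack_boundary b) = 0.
Proof.
apply/eqP; rewrite zquot_pi_eq0; apply/asboolP.
by exists b, 0; rewrite mul0rn addr0.
Qed.

Lemma boundary_mod_mulrn (x : Quotient.quot boundary_mod) : x *+ N = 0.
Proof.
rewrite -[x]zquot_reprK -raddfMn; apply/eqP.
rewrite zquot_pi_eq0; apply/asboolP.
by exists 0, (repr x); rewrite raddf0 add0r.
Qed.

End BoundaryMod.

Section Chains.
Variable X : rackType.

Lemma tuple3P (P : 3.-tuple X -> Prop) :
  (forall a b c, P [tuple a; b; c]) -> forall x, P x.
Proof.
move=> H [[|a [|b [|c [|]]]] // sx].
by rewrite (_ : Tuple sx = [tuple a; b; c]) //; apply: val_inj.
Qed.

Lemma tuple4P (P : 4.-tuple X -> Prop) :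
  (forall a b c d, P [tuple a; b; c; d]) -> forall x, P x.
Proof.
move=> H [[|a [|b [|c [|d [|]]]]] // sx].
by rewrite (_ : Tuple sx = [tuple a; b; c; d]) //; apply: val_inj.
Qed.

Lemma rack_boundary_boundary4 (c : rack_chain X 4) :
  rack_boundary (rack_boundary c) = 0.
Proof.
move: c; apply: freeg_morphism_eq0 => [x y|]; first by rewrite !raddfB.
elim/tuple4P => a1 a2 a3 a4 /=.
rewrite rack_boundary4 !(raddfB, raddfD) /= !rack_boundary3 -!rack_opDl.
by zmod.
Qed.

End Chains.

Section DihedralChains.
Variable p : nat.
Local Notation R := (dihedral p).

Definition cell2 (a b : 'Z_p) : rack_chain R 2 :=
  << [tuple (a : R); (b : R)] >>.
Definition cell3 (a b c : 'Z_p) : rack_chain R 3 :=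
  << [tuple (a : R); (b : R); (c : R)] >>.
Definition cell4 (a b c d : 'Z_p) : rack_chain R 4 :=
  << [tuple (a : R); (b : R); (c : R); (d : R)] >>.

Lemma dihedral_rack_opE (a b : 'Z_p) : rack_op (a : R) (b : R) = b *+ 2 - a.
Proof. by rewrite -mulr_natl. Qed.

Lemma boundary_cell3 a b c : rack_boundary (cell3 a b c)
  = cell2 a c - cell2 (b *+ 2 - a) c - cell2 a b
    + cell2 (c *+ 2 - a) (c *+ 2 - b).
Proof. by rewrite /cell3 rack_boundary3 !dihedral_rack_opE. Qed.

Lemma boundary_cell4 a b c d : rack_boundary (cell4 a b c d)
  = cell3 a c d - cell3 (b *+ 2 - a) c d
    - cell3 a b d + cell3 (c *+ 2 - a) (c *+ 2 - b) d
    + cell3 a b c - cell3 (d *+ 2 - a) (d *+ 2 - b) (d *+ 2 - c).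
Proof. by rewrite /cell4 rack_boundary4 !dihedral_rack_opE. Qed.

Variable V : zmodType.

Lemma chain3_morphism_eq0 (f : rack_chain R 3 -> V) :
  zmod_morphism f -> (forall a b c, f (cell3 a b c) = 0) -> forall z, f z = 0.
Proof.
move=> fB f0; apply: freeg_morphism_eq0 => //.
by elim/tuple3P => a b c; apply: f0.
Qed.

Lemma chain4_morphism_eq0 (f : rack_chain R 4 -> V) :
    zmod_morphism f -> (forall a b c d, f (cell4 a b c d) = 0) ->
  forall z, f z = 0.
Proof.
move=> fB f0; apply: freeg_morphism_eq0 => //.
by elim/tuple4P => a b c d; apply: f0.
Qed.

Lemma cochain_cocycle (f : {additive rack_chain R 3 -> V}) :
  (forall b : rack_chain R 4, f (rack_boundary b) = 0) ->
  cocycle (fun z k u => f (cell3 (z + k + u) (z + k) z)).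
Proof.
move=> fb z k v u; rewrite /d3.
have := fb (cell4 (z + k + v + u) (z + k + v) (z + k) z).
rewrite boundary_cell4 !(raddfB, raddfD) /=.
pose T a b c := f (cell3 a b c).
rewrite -!/(T _ _ _); zcongr T => H; zlin H.
Qed.

Definition ext2 (F : 'Z_p -> 'Z_p -> V) : rack_chain R 2 -> V :=
  freeg_ext (fun x : 2.-tuple R =>
    let y i := nth (0 : 'Z_p) x i in F (y 1%N) (y 0%N - y 1%N)).

Definition ext3 (X : 'Z_p -> 'Z_p -> 'Z_p -> V) : rack_chain R 3 -> V :=
  freeg_ext (fun x : 3.-tuple R => let y i := nth (0 : 'Z_p) x i in
    X (y 2%N) (y 1%N - y 2%N) (y 0%N - y 1%N)).

HB.instance Definition _ F := GRing.Additive.copy (ext2 F) (freeg_ext _).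
HB.instance Definition _ X := GRing.Additive.copy (ext3 X) (freeg_ext _).

Lemma ext2_cell F a b : ext2 F (cell2 a b) = F b (a - b).
Proof. exact: freeg_extU. Qed.

Lemma ext3_cell X a b c : ext3 X (cell3 a b c) = X c (b - c) (a - b).
Proof. exact: freeg_extU. Qed.

Lemma ext2_boundary F a b c :
  ext2 F (rack_boundary (cell3 a b c)) = d2 F c (b - c) (a - b).
Proof.
rewrite boundary_cell3 !(raddfB, raddfD) /= !ext2_cell /d2.
by zcongr2 F; zmod.
Qed.

Lemma ext3_boundary X : cocycle X ->
  forall b : rack_chain R 4, ext3 X (rack_boundary b) = 0.
Proof.
move=> cX; apply: chain4_morphism_eq0 => [x y|a b c d].
  by rewrite !raddfB.
rewrite boundary_cell4 !(raddfB, raddfD) /= !ext3_cell.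
have := cX d (c - d) (b - c) (a - b); rewrite /d3.
by zcongr X => H; zlin H.
Qed.

End DihedralChains.

Lemma subrBB (V : zmodType) (a a' b b' c c' : V) :
  a - a' - (b - b') - (c - c') = a - b - c - (a' - b' - c').
Proof. by zmod. Qed.

Lemma subrBBB (V : zmodType) (a a' b b' c c' d d' : V) :
  a - a' - (b - b') - (c - c') - (d - d') = a - b - c - d - (a' - b' - c' - d').
Proof. by zmod. Qed.

(** * The third homology group *)

Section Homology.
Variable p : nat.
Hypotheses (p_prime : prime p) (p_odd : odd p).
Local Notation R := (dihedral p).

Definition chain_deg : rack_chain R 3 -> int := @deg (3.-tuple R).
Definition carry_hom : rack_chain R 3 -> 'Z_p := ext3 (@carry_cocycle p).

HB.instance Definition _ := GRing.Additive.copy chain_deg (@deg (3.-tuple R)).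
HB.instance Definition _ := GRing.Additive.copy carry_hom (ext3 _).

Lemma chain_deg_cell (a b c : 'Z_p) : chain_deg (cell3 a b c) = 1.
Proof. exact: degU. Qed.

Lemma carry_hom_cell (a b c : 'Z_p) :
  carry_hom (cell3 a b c) = carry_cocycle c (b - c) (a - b).
Proof. exact: ext3_cell. Qed.

Lemma chain_deg_boundary (b : rack_chain R 4) : chain_deg (rack_boundary b) = 0.
Proof.
move: b; apply: chain4_morphism_eq0 => [x y|a b c d]; first by rewrite !raddfB.
by rewrite boundary_cell4 !(raddfB, raddfD) /= !chain_deg_cell.
Qed.

Lemma carry_hom_boundary (b : rack_chain R 4) : carry_hom (rack_boundary b) = 0.
Proof. exact/ext3_boundary/carry_cocycleP. Qed.

Lemma cell3E (a b c : 'Z_p) :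
  cell3 a b c = cell3 (c + (b - c) + (a - b)) (c + (b - c)) c.
Proof. by congr cell3; zmod. Qed.

(** For the tautological cocycle in [C_3 / B_3], [cocycle_mulp] writes [p] times the projection as a
    multiple of the degree plus a function of the boundary; both vanish at [z]. *)
Lemma degree0_cycle_mulp (z : rack_chain R 3) :
    rack_boundary z = 0 -> chain_deg z = 0 ->
  exists b : rack_chain R 4, z *+ p = rack_boundary b.
Proof.
move=> z_cycle z_deg; pose phi := zquot_pi (@boundary_mod R 3 0).
have phiB : {morph phi : x y / x - y} by apply: raddfB.
have cX := cochain_cocycle (f := phi) (@boundary_mod_boundary R 3 0).
have [F FE] := cocycle_mulp p_prime p_odd cX.
pose f c := phi c *+ p - (phi (cell3 0 0 0) *+ p) *~ chain_deg c
  - ext2 F (rack_boundary c).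
have : f z = 0.
  apply: chain3_morphism_eq0 => [x y|a b c].
    rewrite /f phiB (raddfB chain_deg) (raddfB (@rack_boundary R 3)).
    by rewrite (raddfB (ext2 F)) mulrnBl mulrzBr subrBB.
  rewrite /f chain_deg_cell ext2_boundary cell3E FE mulr1z !addr0.
  by rewrite -addrA -opprD subrr.
rewrite /f z_deg z_cycle (raddf0 (ext2 F)) mulr0z !subr0 -raddfMn.
move=> /boundary_modP[b [d ->]]; exists b.
by rewrite mulr0n addr0.
Qed.

(** The tautological cocycle modulo [B_3 + p C_3] is, by the classification, a combination of
    degree, carry cocycle and a coboundary, so [z] lies in that subgroup. *)
Lemma cycle_is_boundary (z : rack_chain R 3) :
    rack_boundary z = 0 -> chain_deg z = 0 -> carry_hom z = 0 ->
  exists b : rack_chain R 4, rack_boundary b = z.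
Proof.
move=> z_cycle z_deg z_carry; pose phi := zquot_pi (@boundary_mod R 3 p).
have phiB : {morph phi : x y / x - y} by apply: raddfB.
have cphi := cochain_cocycle (f := phi) (@boundary_mod_boundary R 3 p).
pose e := phi (cell3 0 0 0).
pose X (y k u : 'Z_p) := phi (cell3 (y + k + u) (y + k) y) - e.
have cX : cocycle X.
  move=> y k v u; rewrite -[RHS](cphi y k v u).
  exact: (d3_sub_cst (fun y k u => phi (cell3 (y + k + u) (y + k) y))).
have X0 : X 0 0 0 = 0 by rewrite /X !add0r subrr.
have mulp := @boundary_mod_mulrn R 3 p.
have [w [F FE]] := cocycle_classification p_prime p_odd mulp cX X0.
pose f c := phi c - e *~ chain_deg c - zpact w (carry_hom c)
  - ext2 F (rack_boundary c).
have : f z = 0.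
  apply: chain3_morphism_eq0 => [x y|a b c].
    rewrite /f phiB (raddfB chain_deg) (raddfB (@rack_boundary R 3)).
    rewrite (raddfB (ext2 F)) (raddfB carry_hom) mulrzBr.
    by rewrite (zpactD p_prime mulp) (zpactN p_prime mulp) subrBBB.
  rewrite /f chain_deg_cell ext2_boundary carry_hom_cell cell3E mulr1z.
  have := FE c (b - c) (a - b); rewrite /X => ->.
  by zmod.
rewrite /f z_deg z_cycle z_carry (raddf0 (ext2 F)) mulr0z zpact0 !subr0.
move=> /boundary_modP[b [d zE]].
(* The chain [d] is itself a cycle of degree 0, because [p] times its boundary and [p] times its
   degree vanish in torsion-free groups. *)
have [b' dE] : exists b' : rack_chain R 4, d *+ p = rack_boundary b'.
  apply: degree0_cycle_mulp.
    apply: (@freeg_mulrn_eq0 _ _ p); first exact: prime_gt0.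
    rewrite -raddfMn; have := congr1 (@rack_boundary R 3) zE.
    by rewrite raddfD /= rack_boundary_boundary4 add0r z_cycle => <-.
  have := congr1 chain_deg zE.
  rewrite raddfD /= chain_deg_boundary add0r z_deg raddfMn => /esym/eqP.
  by rewrite Num.Theory.mulrn_eq0 eqn0Ngt prime_gt0 //= => /eqP.
by exists (b + b'); rewrite raddfD zE dE.
Qed.

(* Evaluating a cocycle [X] on [sigma_chain z] gives [sigma X z]. *)
Definition sigma_chain (z : 'Z_p) : rack_chain R 3 :=
  \sum_k cell3 (z + k + 1) (z + k) z.

(** The right-hand side does not involve [z], so differences of such chains are cycles. *)
Lemma sigma_chain_boundary (z : 'Z_p) :
  rack_boundary (sigma_chain z)
  = \sum_y cell2 (y - 1) y - \sum_y cell2 (y + 1) y.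
Proof.
rewrite raddf_sum /=.
pose g a := cell2 a z.
pose h (y : 'Z_p) := cell2 (y + 1) y; pose h' (y : 'Z_p) := cell2 (y - 1) y.
transitivity
  (\sum_k (g (z + 1 + k) - g (z - 1 + k) - h (z + k) + h' (z + - k))).
  apply: eq_bigr => k _; rewrite boundary_cell3 /g /h /h'.
  by move: 1 => e; zcongr2 (@cell2 p); zmod.
rewrite !(big_split, sumrN) /= !(sum_shift g) (sum_shift h).
by rewrite (sum_opp (fun k => h' (z + k))) (sum_shift h') subrr sub0r addrC.
Qed.

Lemma chain_deg_sigma (z : 'Z_p) : chain_deg (sigma_chain z) = p%:Z.
Proof.
rewrite raddf_sum /= -[RHS]natz -(sum_cst p_prime (1 : int)).
by apply: eq_bigr => k _; rewrite chain_deg_cell.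
Qed.

Lemma carry_hom_sigma (z : 'Z_p) :
  carry_hom (sigma_chain z) = carry_hom (sigma_chain 0) - z *+ 2.
Proof.
have E y : carry_hom (sigma_chain y) = (\sum_k carry y k)%:~R.
  rewrite raddf_sum -[RHS]/(_ *~ _) mulrz_sumr; apply: eq_bigr => k _ /=.
  rewrite carry_hom_cell /carry_cocycle.
  have -> : y + k + 1 - (y + k) = 1 by rewrite addrC addKr.
  by rewrite mul1r; congr ((carry _ _)%:~R); rewrite addrC addKr.
by rewrite !E sum_carry // mulrzBr !mulr2n mulrzDr -!pmulrn natr_Zp.
Qed.

Lemma invariants_surjective (n : int) (r : 'Z_p) :
  exists z, [/\ rack_boundary z = 0, chain_deg z = n & carry_hom z = r].
Proof.
pose w := sigma_chain 1 - sigma_chain 0; pose e := cell3 (0 : 'Z_p) 0 0.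
have e_cycle : rack_boundary e = 0.
  by rewrite boundary_cell3; zcongr2 (@cell2 p); zmod.
have w_cycle : rack_boundary w = 0.
  by rewrite raddfB /= !sigma_chain_boundary subrr.
(* [w] has degree 0 and carry value -2, while [e] has degree 1 and carry value 0; hence the
   coefficient [-r/2] of [w]. *)
have [s sE] : exists s : 'Z_p, s = - zhalf r by exists (- zhalf r).
exists (e *~ n + w *+ s); split.
- by rewrite raddfD raddfMz raddfMn /= e_cycle w_cycle mul0rz mul0rn addr0.
- rewrite raddfD raddfMz raddfMn raddfB /= !chain_deg_sigma subrr mul0rn addr0.
  by rewrite chain_deg_cell intz.
rewrite raddfD raddfMz raddfMn raddfB /= carry_hom_sigma carry_hom_cell.
rewrite /carry_cocycle subrr mul0r mul0rz add0r addrAC subrr sub0r.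
have natE (x y : 'Z_p) : x *+ y = x * y by rewrite -mulr_natr natr_Zp.
by rewrite natE sE mulNr mulrN opprK mulrnAl mul1r half_mul2.
Qed.

Definition invariants (z : rack_cycle R 3) : (int * 'Z_p)%type :=
  (chain_deg (val z), carry_hom (val z)).

Lemma invariants_is_zmod_morphism : zmod_morphism invariants.
Proof. by move=> x y; rewrite /invariants !raddfB. Qed.

HB.instance Definition _ :=
  GRing.isZmodMorphism.Build (rack_cycle R 3) (int * 'Z_p)%type invariants
    invariants_is_zmod_morphism.

Lemma invariants_eq0 z : (invariants z == 0) = (z \in @is_boundary R 3).
Proof.
apply/eqP/asboolP => [[z_deg z_carry]|[b bE]].
  by apply: cycle_is_boundary => //; apply/eqP; case: z {z_deg z_carry}.
by rewrite /invariants -bE chain_deg_boundary carry_hom_boundary.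
Qed.

End Homology.

Theorem mainTheorem1 (p : nat) (p_prime : prime p) (p_odd : odd p) :
  isomorphic (rack_homology (dihedral p) 3) (int * 'Z_p)%type.
Proof.
apply: (zquot_isomorphic (f := @invariants p)) => [z|[n r]].
  exact: invariants_eq0.
have [z [/eqP z_cycle z_deg z_carry]] :=
  invariants_surjective p_prime p_odd n r.
by exists (RackCycle z_cycle); rewrite -z_deg -z_carry.
Qed.
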